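(* Consider the Bayesian game described in the context, with $u_i$ continuous over $\mathcal{A}\times\Theta$ for every $i\in N$. For $d=1,2,\ldots$ let $f_d=((f_d)_1,\ldots,(f_d)_n)\in S_d$ satisfy $$f_d\in\arg\max_{g_d\in S_d}\ \sum_{i=1}^n\mathbb{E}_\eta\big[u_i((g_d)_i(\theta_i),(f_d)_{-i}(\theta_{-i}),\theta)\big].$$ Then every cluster point $f$ (with respect to the infinity norm) of $\{f_d\}$ satisfies $$f\in\arg\max_{g\in\mathcal{C}}\ \sum_{i=1}^n\mathbb{E}_\eta\big[u_i(g_i(\theta_i),f_{-i}(\theta_{-i}),\theta)\big].$$
   Context: There are $n$ players, $N=\{1,\ldots,n\}$. For each $i$, the type set $\Theta_i\subset\mathbb{R}$ and the action space $\mathcal{A}_i\subset\mathbb{R}$ are compact intervals. $\Theta=\Theta_1\times\cdots\times\Theta_n$, $\mathcal{A}=\mathcal{A}_1\times\cdots\times\mathcal{A}_n$; the subscript $-i$ denotes the vector over all players except $i$. Player $i$ has utility $u_i(a,\theta)=u_i(a_i,a_{-i},\theta)$. $\eta$ is the joint probability distribution of $\theta$ on $\Theta$ and $\mathbb{E}_\eta$ is expectation with respect to $\eta$. $\mathcal{C}_i$ is the set of continuous functions $\Theta_i\to\mathcal{A}_i$ and $\mathcal{C}=\mathcal{C}_1\times\cdots\times\mathcal{C}_n$, with the infinity norm. With $\xi_d(t):=(1,t,t^2,\ldots,t^d)^T$, $S_d^i$ is the set of functions $s:\Theta_i\to\mathcal{A}_i$ for which there is $v\in\mathbb{R}^{d+1}$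 with $s(t)=v^T\xi_d(t)$ (polynomials of degree at most $d$ mapping $\Theta_i$ into $\mathcal{A}_i$), and $S_d:=S_d^1\times\cdots\times S_d^n$. *)

(* Defs.v *)
From mathcomp Require Export all_boot all_order all_algebra.
From mathcomp Require Export all_classical all_reals all_analysis.
Export Order.TTheory GRing.Theory Num.Theory.
Export numFieldNormedType.Exports.

Set Implicit Arguments.
Unset Strict Implicit.
Unset Printing Implicit Defensive.

Local Open Scope classical_set_scope.
Local Open Scope ring_scope.

(* The prior is a Borel probability on R^n carried by the product of the type
   intervals.  Only the values of [utility] on actions x types matter. *)
Record bayesian_game (R : realType) (n : nat) := BayesianGame {
  type_lo : 'I_n -> R;
  type_hi : 'I_n -> R;
  type_le : forall i, type_lo i <= type_hi i;
  action_lo : 'I_n -> R;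
  action_hi : 'I_n -> R;
  action_le : forall i, action_lo i <= action_hi i;
  utility : 'I_n -> 'rV[R]_n -> 'rV[R]_n -> R;
  prior : probability (g_sigma_algebraType (@open 'rV[R]_n)) R;
  prior_types :
    prior [set th | forall i, th ord0 i \in `[type_lo i, type_hi i]] = 1%E
}.

Section BayesianGame.
Context {R : realType} {n : nat} (G : bayesian_game R n).

Definition type_set (i : 'I_n) : set R := `[type_lo G i, type_hi G i].
Definition action_set (i : 'I_n) : set R := `[action_lo G i, action_hi G i].

Definition types : set 'rV[R]_n := [set th | forall i, type_set i (th ord0 i)].
Definition actions : set 'rV[R]_n :=
  [set a | forall i, action_set i (a ord0 i)].

(* A function from type_set i to action_set i is represented by a function
   R -> R of which only the restriction to type_set i matters: every notion
   below depends on the values on the type sets alone. *)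
Definition profile := 'I_n -> R -> R.

Definition strategy (i : 'I_n) : set (R -> R) :=
  [set s | {homo s : t / type_set i t >-> action_set i t}].

Definition cont_strategy (i : 'I_n) : set (R -> R) :=
  [set s | strategy i s /\ {within type_set i, continuous s}].

Definition cont_profile : set profile :=
  [set f | forall i, cont_strategy i (f i)].

Definition xi (d : nat) (t : R) : 'cV[R]_d.+1 := \col_k t ^+ k.

Definition poly_strategy (d : nat) (i : 'I_n) : set (R -> R) :=
  [set s | strategy i s /\
    exists v : 'cV[R]_d.+1,
      forall t, type_set i t -> s t = (v^T *m xi d t) ord0 ord0].

Definition poly_profile (d : nat) : set profile :=
  [set f | forall i, poly_strategy d i (f i)].

(* Valued in \bar R, so that no boundedness is needed for it to be the
   supremum. *)
Definition infnorm (h : profile) : \bar R :=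
  \big[maxe/0%E]_(i < n) ereal_sup [set `|h i t|%:E | t in type_set i].

Definition cluster_point (fd : nat -> profile) (f : profile) : Prop :=
  cont_profile f /\
  forall e : R, 0 < e -> forall D : nat, exists2 d : nat, (D <= d)%N &
    (infnorm (fun i t => fd d i t - f i t)%R < e%:E)%E.

(* (g_i, f_{-i}) *)
Definition deviate (i : 'I_n) (g f : profile) : profile :=
  fun j => if j == i then g j else f j.

Definition play (s : profile) (th : 'rV[R]_n) : 'rV[R]_n :=
  \row_j s j (th ord0 j).

(* The integrand is extended by 0 outside the support [types] of the prior. *)
Definition total_payoff (f g : profile) : \bar R :=
  (\sum_(i < n) 'E_(prior G)
     [(fun th => utility G i (play (deviate i g f) th) th) \_ types])%E.

End BayesianGame.

Definition argmax {R : realType} {T : Type} (S : set T) (F : T -> \bar R) :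
    set T :=
  [set x | S x /\ forall y, S y -> (F y <= F x)%E].

(* Main.v *)
Require Import Defs.
From mathcomp Require Import lra.

(** Fix a continuous competitor [g] and [e > 0].  The total payoff is uniformly
    continuous in both the strategies faced and the deviations
    ([total_payoff_near]): the utilities are uniformly continuous on the compact
    set of actions x types, and a function that moves by at most [e] has an
    expectation that moves by at most [e].  Let [r] be the radius attached to
    [e / 2].  The polynomial profiles of all large degrees come within [r] of [g]
    ([poly_profile_dense]), and some [fd d] of large degree [d] is within [r] of
    the cluster point [f].  With [gd] a polynomial profile of that same degree
    near [g],

      payoff f g <= payoff (fd d) gd + e/2
                 <= payoff (fd d) (fd d) + e/2 <= payoff f f + e,

    the middle step being the optimality of [fd d] among profiles of degree [d].

    Density needs polynomials that keep their values in the action interval and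
    exist in every large degree; Bernstein polynomials have both properties.
    Bernstein's proof of the Weierstrass theorem only uses that the Bernstein
    operator is monotone ([bernstein_le]) and its value on quadratics
    ([bernstein_quadratic]).  Expectations can be compared because the integrand,
    continuous on the compact set of types, is Borel measurable and bounded
    ([within_continuous_integrable]). *)

Set Implicit Arguments.
Unset Strict Implicit.

Local Open Scope classical_set_scope.
Local Open Scope ring_scope.

(** * Bernstein polynomials and the Weierstrass theorem *)

(** At a point where [l] takes the value [x], this is the expectation of [F] at
    the number of successes in [d] independent trials of success probability [x],
    i.e. [\sum_k 'C(d, k) x^k (1 - x)^(d - k) F k].  Conditioning on one trial
    gives the recursion, from which monotonicity and moments follow by induction
    without binomial coefficients. *)
Fixpoint bernstein (R : comNzRingType) (l : {poly R}) (d : nat) (F : nat -> R) :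
    {poly R} :=
  if d is d'.+1
  then l * bernstein l d' (fun k => F k.+1) + (1 - l) * bernstein l d' F
  else (F 0%N)%:P.

Lemma size_bernstein (R : comNzRingType) (l : {poly R}) (d : nat) (F : nat -> R) :
  (size l <= 2)%N -> (size (bernstein l d F) <= d.+1)%N.
Proof.
move=> size_l; elim: d F => [|d IHd] F /=; first by rewrite size_polyC leq_b1.
have size_mul (p q : {poly R}) : (size p <= 2)%N -> (size q <= d.+1)%N ->
    (size (p * q)%R <= d.+2)%N.
  move=> p2 qd; apply: leq_trans (size_polyMleq _ _) _.
  by rewrite -subn1 leq_subLR; exact: (leq_add p2 qd).
apply: leq_trans (size_polyD _ _) _; rewrite geq_max !size_mul//.
by rewrite (leq_trans (size_polyD _ _))// size_polyN size_poly1 geq_max size_l.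
Qed.

Lemma bernstein_le (R : realDomainType) (l : {poly R}) (t : R) (d : nat)
    (F G : nat -> R) :
  0 <= l.[t] <= 1 -> (forall k, (k <= d)%N -> F k <= G k) ->
  (bernstein l d F).[t] <= (bernstein l d G).[t].
Proof.
move=> /andP[l0 l1]; elim: d F G => [|d IHd] F G FG /=.
  by rewrite !hornerC FG.
rewrite !hornerE lerD// ler_wpM2l ?subr_ge0//; apply: IHd => k kd.
  exact: FG.
by apply: FG; apply: leqW.
Qed.

(** The second moment of the binomial law about [c]: its variance plus the
    square of the distance from its mean to [c]. *)
Lemma bernstein_quadratic (R : realFieldType) (l : {poly R}) (t a b c : R)
    (d : nat) :
  (bernstein l d (fun k => a + b * (k%:R - c) ^+ 2)).[t] =
  a + b * (d%:R * l.[t] * (1 - l.[t]) + (d%:R * l.[t] - c) ^+ 2).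
Proof.
elim: d c => [|d IHd] c /=; first by rewrite hornerC; lra.
have -> : (fun k : nat => a + b * (k.+1%:R - c) ^+ 2) =
          (fun k : nat => a + b * (k%:R - (c - 1)) ^+ 2).
  by apply/funext => k; congr (_ + _ * _ ^+ 2); rewrite -natr1; lra.
rewrite !(hornerD, hornerM, hornerN, hornerC) !IHd -natr1; lra.
Qed.

(** Heine's theorem for a function continuous on a compact set: around each
    point of [K] half of its radius of continuity works, and compactness turns
    these local radii into a single one. *)
Lemma compact_uniformly_continuous (R : realType) (T : pseudoMetricType R)
    (K : set T) (f : T -> R) :
  compact K -> {within K, continuous f} ->
  forall e : R, 0 < e -> \forall r \near 0^'+,
    forall x y, K x -> K y -> ball x r y -> `|f x - f y| < e.
Proof.
move=> /compact_near_coveringP cK /subspace_continuousP cf e e0.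
pose P (r : R) (x : T) := forall y, K x -> K y -> ball x r y -> `|f x - f y| < e.
suff KP : \forall r \near 0^'+, K `<=` P r.
  by apply: filterS KP => r KP x y Kx; exact: KP.
apply: cK => x Kx.
have e20 : 0 < e / 2 by rewrite divr_gt0.
have /cvgrPdist_lt/(_ _ e20) := cf _ Kx; rewrite near_withinE.
move=> /nbhs_ballP[r /= r0 xr].
exists (ball x (r / 2), [set s | s < r / 2]) => /=.
  split; first by apply: nbhsx_ballx; rewrite divr_gt0.
  by apply: nbhs_right_lt; rewrite divr_gt0.
move=> [x' s] /= [xx' sr] y Kx' Ky x'y.
have fx' : `|f x - f x'| < e / 2.
  by apply: xr => //; apply: le_ball xx'; rewrite ler_pdivrMr// ler_pMr// ler1n.
have fy : `|f x - f y| < e / 2.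
  apply: xr => //; rewrite [r]splitr; apply: ball_triangle xx' _.
  by apply: le_ball x'y; exact: ltW.
rewrite [e]splitr (_ : f x' - f y = (f x - f y) - (f x - f x')); last by lra.
by rewrite (le_lt_trans (ler_normB _ _))// ltrD.
Qed.

(** If [|x - y| < r] forces [|f x - f y| < e / 2], then everywhere on the interval
    [|f x - f t| <= e / 2 + (b - a) * ((x - t) / r)^2], since [f] oscillates by at
    most [b - a] and the last term is at least that once [r <= |x - t|].  The Bernstein
    operator maps the quadratic bound to [e / 2 + O(1 / d)].  Being an average, it
    also maps values in [[a, b]] to values in [[a, b]]. *)
Lemma weierstrass_range (R : realType) (lo hi a b : R) (f : R -> R) :
  lo <= hi -> {within `[lo, hi], continuous f} ->
  {homo f : t / t \in `[lo, hi] >-> t \in `[a, b]} ->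
  forall e : R, 0 < e -> exists D : nat, forall d, (D <= d)%N ->
  exists p : {poly R}, [/\ (size p <= d.+1)%N,
    {homo (horner p) : t / t \in `[lo, hi] >-> t \in `[a, b]} &
    forall t, t \in `[lo, hi] -> `|p.[t] - f t| < e].
Proof.
move=> lohi cf fab e e0.
have e20 : 0 < e / 2 by rewrite divr_gt0.
have [r [r0 fr]] := filter_ex (filterI (nbhs_right_gt (0 : R))
  (compact_uniformly_continuous (@segment_compact _ lo hi) cf e20)).
have ab : 0 <= b - a.
  have /fab : lo \in `[lo, hi] by rewrite in_itv/= lexx.
  by rewrite in_itv/= => /andP[al lb]; rewrite subr_ge0 (le_trans al lb).
pose C := (b - a) * ((hi - lo) / r) ^+ 2.
have C0 : 0 <= C by rewrite mulr_ge0// sqr_ge0.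
pose D := (Num.truncn (e^-1 * (C * 2))).+1.
exists D => d Dd.
have d0 : 0 < d%:R :> R by rewrite ltr0n (leq_trans _ Dd).
(* The affine map of [lo, hi] onto [0, 1]; when lo = hi the inverse is 0, so l
   vanishes and the formulas below remain true. *)
pose l : {poly R} := (hi - lo)^-1 *: ('X - lo%:P).
pose pt (k : nat) := lo + k%:R / d%:R * (hi - lo).
have lE t : t \in `[lo, hi] -> 0 <= l.[t] <= 1 /\ t = lo + l.[t] * (hi - lo).
  rewrite in_itv/= => /andP[lot thi].
  rewrite /l !hornerE.
  have [lohi0|lohi0] := eqVneq hi lo.
    rewrite lohi0 subrr invr0 mul0r lexx ler01; split=> //.
    by rewrite mul0r addr0; apply/eqP; rewrite eq_le lot -lohi0 thi.
  have hl0 : 0 < hi - lo by rewrite subr_gt0 lt_neqAle eq_sym lohi0.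
  split; last by rewrite mulrAC mulVf ?gt_eqF// mul1r; lra.
  rewrite mulr_ge0 ?invr_ge0 ?subr_ge0//= mulrC ler_pdivrMr// mul1r.
  by rewrite lerB.
have ptI k : (k <= d)%N -> pt k \in `[lo, hi].
  move=> kd; rewrite in_itv/= /pt lerDl mulr_ge0 ?divr_ge0 ?subr_ge0//=.
  rewrite -lerBrDl ler_piMl ?subr_ge0// ler_pdivrMr// mul1r ler_nat//.
exists (bernstein l d (f \o pt)); split.
- apply: size_bernstein; rewrite (leq_trans (size_scale_leq _ _))//.
  by rewrite size_XsubC.
- move=> t /lE[l01 _].
  have cst c : (bernstein l d (fun=> c)).[t] = c.
    transitivity (bernstein l d (fun k => c + 0 * (k%:R - 0) ^+ 2)).[t].
      congr (bernstein _ _ _).[_].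
      by apply/funext => k; rewrite mul0r addr0.
    by rewrite bernstein_quadratic mul0r addr0.
  rewrite in_itv/=; apply/andP; split; [rewrite -[leLHS]cst|rewrite -[leRHS]cst];
    apply: bernstein_le => // k kd; have := fab _ (ptI _ kd);
    by rewrite in_itv/= => /andP[].
- move=> t It; have [l01 tE] := lE _ It.
  have near_value k : (k <= d)%N -> `|f (pt k) - f t| <=
      e / 2 + C / d%:R ^+ 2 * (k%:R - d%:R * l.[t]) ^+ 2.
    move=> kd; have Ik := ptI _ kd.
    have kt : pt k - t = (k%:R - d%:R * l.[t]) / d%:R * (hi - lo).
      by rewrite [in LHS]tE mulrBl mulrAC divff ?gt_eqF// /pt; lra.
    have [near_t|far_t] := ltP `|pt k - t| r.
      apply: ler_wpDr; last by apply: ltW; apply: fr.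
      by rewrite mulr_ge0 ?sqr_ge0 ?divr_ge0 ?sqr_ge0.
    rewrite (@le_trans _ _ (b - a))//.
      have := fab _ It; have := fab _ Ik.
      rewrite !in_itv/= => /andP[? ?] /andP[? ?].
      by rewrite ler_norml; lra.
    rewrite ler_wpDl ?(ltW e20)//.
    have -> : C / d%:R ^+ 2 * (k%:R - d%:R * l.[t]) ^+ 2 =
        (b - a) * ((pt k - t) / r) ^+ 2.
      by rewrite kt /C -exprVn; lra.
    rewrite ler_peMr// -real_normK ?num_real// expr_ge1// normrM.
    by rewrite normfV (gtr0_norm r0) ler_pdivlMr// mul1r.
  (* s = 1 and s = -1 give the upper and the lower quadratic bound on f. *)
  have moment s : (bernstein l d (fun k => (f t + s * (e / 2)) +
        s * (C / d%:R ^+ 2) * (k%:R - d%:R * l.[t]) ^+ 2)).[t] =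
      f t + s * (e / 2 + C / d%:R * (l.[t] * (1 - l.[t]))).
    rewrite bernstein_quadratic subrr expr0n addr0 expr2.
    have -> y : s * (C / (d%:R * d%:R)) * (d%:R * l.[t] * y) =
        s * (C / d%:R) * (l.[t] * y) * (d%:R^-1 * d%:R).
      by rewrite invfM; lra.
    by rewrite mulVf ?gt_eqF// mulr1; lra.
  have small : C / d%:R * (l.[t] * (1 - l.[t])) < e / 2.
    have [l0 l1] := andP l01.
    rewrite (@le_lt_trans _ _ (C / d%:R))//.
      rewrite ler_piMr ?divr_ge0 ?(ltW d0)// mulr_ile1// ?subr_ge0//.
      by rewrite gerBl.
    rewrite ltr_pdivrMr// mulrAC ltr_pdivlMr// mulrC -ltr_pdivrMl//.
    rewrite mulrC (lt_le_trans (truncnS_gt _))// ler_nat//.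
  have upper : (bernstein l d (f \o pt)).[t] < f t + e.
    apply: (@le_lt_trans _ _
      (f t + 1 * (e / 2 + C / d%:R * (l.[t] * (1 - l.[t]))))).
      rewrite -moment; apply: bernstein_le => // k /near_value /=.
      by rewrite ler_norml => /andP[_]; lra.
    lra.
  have lower : f t - e < (bernstein l d (f \o pt)).[t].
    apply: (@lt_le_trans _ _
      (f t + -1 * (e / 2 + C / d%:R * (l.[t] * (1 - l.[t]))))).
      lra.
    rewrite -moment; apply: bernstein_le => // k /near_value /=.
    by rewrite ler_norml => /andP[+ _]; lra.
  by rewrite ltr_norml; lra.
Qed.

(** * Integrability and comparison of expectations *)

Lemma closed_borel_measurable (T : ptopologicalType) (A : set T) :
  closed A -> measurable (A : set (g_sigma_algebraType (@open T))).
Proof.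
move=> cA; rewrite -[A]setCK; apply: measurableC.
by apply: sub_sigma_algebra; exact: closed_openC.
Qed.

Lemma within_continuous_borel_measurable (R : realType) (T : ptopologicalType)
    (A : set T) (h : T -> R) :
  closed A -> {within A, continuous h} ->
  measurable_fun [set: g_sigma_algebraType (@open T)] (h \_ A).
Proof.
move=> cA /continuousP ch.
apply/(@measurable_restrictT _ _ (g_sigma_algebraType (@open T)) _ A h).
  exact: closed_borel_measurable.
apply: (measurability _ (measurable_realfun.RGenOpens.measurableE R)).
move=> _ [_ [a [b ->] <-]].
have /open_subspaceP[V oV VA] :=
  ch _ (interval_open (a:=BRight a) (b:=BLeft b) erefl erefl).
have mVA : measurable (V `&` A : set (g_sigma_algebraType (@open T))).
  apply: measurableI; last exact: closed_borel_measurable.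
  exact: sub_sigma_algebra.
by move: mVA; rewrite VA setIC.
Qed.

Lemma within_continuous_integrable (R : realType) (T : ptopologicalType)
    (P : probability (g_sigma_algebraType (@open T)) R) (A : set T) (h : T -> R) :
  closed A -> compact A -> {within A, continuous h} ->
  P.-integrable setT (EFin \o (h \_ A)).
Proof.
move=> cA kA ch; apply: measurable_bounded_integrable => //.
- exact: le_lt_trans (probability_le1 P measurableT) (ltry 1).
- exact: within_continuous_borel_measurable.
have := compact_bounded (continuous_compact ch kA : compact (_ : set R^o)).
rewrite /bounded_set /bounded_near/= => bA.
near=> M => x _ /=; rewrite patchE; case: ifPn => [/set_mem Ax|_].
  have hM : forall y, (h @` A) y -> `|y : R^o| <= M by near: M.
  by apply: hM; exists x.
by near: M; exact: nbhs_pinfty_ge.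
Unshelve. all: by end_near. Qed.

Lemma le_expectation_restrict (R : realType) (d : measure_display)
    (T : measurableType d) (P : probability T R) (A : set T) (h h' : T -> R)
    (e : R) :
  P.-integrable setT (EFin \o (h \_ A)) ->
  P.-integrable setT (EFin \o (h' \_ A)) ->
  0 <= e -> (forall x, A x -> `|h x - h' x| <= e) ->
  ('E_P[h \_ A] <= 'E_P[h' \_ A] + e%:E)%E.
Proof.
move=> ih ih' e0 hh'.
have ie : P.-integrable setT (EFin \o cst e).
  exact: finite_measure_integrable_cst.
have -> : (e%:E = 'E_P[cst e])%E by rewrite expectation_cst.
rewrite !unlock -integralD//.
apply: le_integral => //; first exact: integrableD.
move=> x _ /=; rewrite lee_fin !patchE; case: ifPn => [/set_mem/hh'|_].
  by rewrite ler_norml; lra.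
by rewrite add0r.
Qed.

(** * The payoff of continuous profiles *)

Section Game.
Context (R : realType) (n : nat) (G : bayesian_game R n).
Context (utility_continuous : forall i : 'I_n,
  {within actions G `*` types G,
     continuous (fun x : 'rV[R]_n * 'rV[R]_n => utility G i x.1 x.2)}).

Lemma types_compact : compact (types G).
Proof. by apply: rV_compact => i; exact: segment_compact. Qed.

Lemma actions_compact : compact (actions G).
Proof. by apply: rV_compact => i; exact: segment_compact. Qed.

Lemma types_closed : closed (types G).
Proof. by apply: compact_closed types_compact; exact: norm_hausdorff. Qed.

Lemma play_actions (s : profile) (th : 'rV[R]_n) :
  (forall i, strategy G i (s i)) -> types G th -> actions G (play s th).
Proof. by move=> sG thG i; rewrite mxE; apply: sG. Qed.

Lemma deviate_cont_profile i (g f : profile) :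
  cont_profile G g -> cont_profile G f -> cont_profile G (deviate i g f).
Proof. by move=> gG fG j; rewrite /deviate; case: eqP. Qed.

Lemma within_continuous_outcome i (s : profile) :
  cont_profile G s ->
  {within types G, continuous (fun th => utility G i (play s th) th)}.
Proof.
move=> sG; have /subspace_continuousP cu := utility_continuous (i := i).
apply/subspace_continuousP => th thG.
have pG th' : types G th' -> actions G (play s th').
  by apply: play_actions => j; case: (sG j).
have play_cvg : play s th' @[th' --> within (types G) (nbhs th)] --> play s th.
  apply/cvg_ballP => e e0; rewrite near_withinE.
  have near_j j : \forall th' \near th, types G th' ->
      ball (s j (th ord0 j)) e (s j (th' ord0 j)).
    have /subspace_continuousP/(_ _ (thG j))/cvg_ballP/(_ _ e0) := (sG j).2.
    rewrite near_withinE => /nbhs_ballP[r /= r0 rP].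
    apply/nbhs_ballP; exists r => //= th' [_ th'r] th'G.
    by apply: rP; [exact: th'r | exact: th'G].
  apply: filterS (filter_forall _ near_j) => th' P th'G.
  by split=> // k j; rewrite !mxE; exact: P.
have pair_cvg : (play s th', th') @[th' --> within (types G) (nbhs th)] -->
    (play s th, th).
  exact: (cvg_pair play_cvg (cvg_within _)).
apply: (cvg_comp (fun th' => (play s th', th')) (fun x => utility G i x.1 x.2)
  _ (cu (play s th, th) (conj (pG _ thG) thG))).
move=> U KU; have := pair_cvg _ KU.
rewrite /= !nbhs_simpl/= /within/=.
apply: filterS => th' KU' th'G; apply: KU' => //.
by split=> //; exact: pG.
Qed.

Definition dist_lt (r : R) (f g : @profile R n) :=
  forall i t, type_set G i t -> `|f i t - g i t| < r.

Lemma dist_ltC r f g : dist_lt r f g -> dist_lt r g f.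
Proof. by move=> fg i t /fg; rewrite distrC. Qed.

Lemma infnorm_dist_lt (e : R) (f g : @profile R n) :
  (infnorm G (fun i t => f i t - g i t)%R < e%:E)%E -> dist_lt e f g.
Proof.
move=> fg i t it; rewrite -lte_fin; apply: le_lt_trans fg.
apply: le_trans (le_bigmax _ _ i).
by apply: ereal_sup_ubound; exists t.
Qed.

Lemma outcome_near i (e : R) : 0 < e -> \forall r \near 0^'+,
  forall s s' th, cont_profile G s -> cont_profile G s' -> dist_lt r s s' ->
    types G th ->
    `|utility G i (play s th) th - utility G i (play s' th) th| < e.
Proof.
move=> e0.
have unif := compact_uniformly_continuous
  (compact_setX actions_compact types_compact) (utility_continuous (i := i)) e0.
near=> r => s s' th sG s'G ss' thG.
have r0 : 0 < r by near: r; exact: nbhs_right_gt.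
have rP : forall x y : 'rV[R]_n * 'rV[R]_n, (actions G `*` types G) x ->
    (actions G `*` types G) y -> ball x r y ->
    `|utility G i x.1 x.2 - utility G i y.1 y.2| < e by near: r.
apply: (rP (play s th, th) (play s' th, th)) => /=.
- by split=> //; apply: play_actions => // j; case: (sG j).
- by split=> //; apply: play_actions => // j; case: (s'G j).
split=> /=; last exact: ballxx.
by split=> // k j; rewrite !mxE; exact: ss'.
Unshelve. all: by end_near. Qed.

(** The radius depends on [e] alone: it serves all continuous profiles at once,
    so that the faced profile and the deviation may vary together. *)
Lemma total_payoff_near (e : R) : 0 < e -> \forall r \near 0^'+,
  forall f f' g g', cont_profile G f -> cont_profile G f' ->
    cont_profile G g -> cont_profile G g' -> dist_lt r f f' -> dist_lt r g g' ->
    (total_payoff G f g <= total_payoff G f' g' + e%:E)%E.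
Proof.
move=> e0; have en0 : 0 < e / n.+1%:R by rewrite divr_gt0.
(* n.+1 instead of n, which may be 0 *)
apply: filterS (filter_forall _ (fun i => outcome_near i en0)) => r rP.
move=> f f' g g' fG f'G gG g'G ff' gg'.
apply: (@le_trans _ _ (\sum_(i < n) ('E_(prior G)
    [(fun th => utility G i (play (deviate i g' f') th) th) \_ (types G)]
    + (e / n.+1%:R)%:E))%E).
  apply: lee_sum => i _; apply: le_expectation_restrict.
  - apply: within_continuous_integrable; [exact: types_closed|
      exact: types_compact|apply: within_continuous_outcome => //].
    exact: deviate_cont_profile.
  - apply: within_continuous_integrable; [exact: types_closed|
      exact: types_compact|apply: within_continuous_outcome => //].
    exact: deviate_cont_profile.
  - exact: ltW.
  move=> th thG; apply/ltW/rP => //; try exact: deviate_cont_profile.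
  by move=> j t jt; rewrite /deviate; case: eqP => _; [exact: gg'|exact: ff'].
rewrite big_split/= leeD2l// sumEFin lee_fin sumr_const card_ord.
by rewrite -[leLHS]mulr_natl mulrA ler_pdivrMr// mulrC ler_pM2l// ler_nat.
Qed.

(** * Polynomial profiles *)

Lemma poly_strategyP d i (s : R -> R) :
  poly_strategy G d i s <-> strategy G i s /\
    exists2 p : {poly R}, (size p <= d.+1)%N &
      forall t, type_set G i t -> s t = p.[t].
Proof.
split=> -[sG].
  move=> [v sv]; split=> //.
  exists (\poly_(k < d.+1) v (inord k) ord0); first exact: size_poly.
  move=> t /sv->; rewrite horner_poly mxE; apply: eq_bigr => k _.
  by rewrite !mxE inord_val.
move=> [p pd sp]; split=> //; exists (\col_k p`_k) => t /sp->.
rewrite (horner_coef_wide _ pd) mxE; apply: eq_bigr => k _.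
by rewrite !mxE.
Qed.

Lemma poly_profile_cont d (s : profile) : poly_profile G d s -> cont_profile G s.
Proof.
move=> sG i; have /poly_strategyP[si [p _ sp]] := sG i; split=> //.
apply: (@subspace_eq_continuous _ _ _ (horner p)).
  by move=> t /set_mem it; apply: esym; exact: sp.
exact/continuous_subspaceT/continuous_horner.
Qed.

(** Every large degree is reached, and not only infinitely many degrees, because
    the approximants must have the degree of a term of the sequence near its
    cluster point. *)
Lemma poly_profile_dense (g : @profile R n) (e : R) : cont_profile G g -> 0 < e ->
  exists D : nat, forall d, (D <= d)%N ->
    exists2 gd, poly_profile G d gd & dist_lt e gd g.
Proof.
move=> gG e0.
have /choice[D DP] i := weierstrass_range (type_le G i) (gG i).2 (gG i).1 e0.
exists (\max_i D i)%N => d Dd.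
have /choice[p pP] i := DP i d (leq_trans (leq_bigmax i) Dd).
exists (fun i => horner (p i)) => i; have [sp pi pg] := pP i.
  by apply/poly_strategyP; split=> //; exists (p i).
by move=> t it; exact: pg.
Qed.

End Game.

(** * Optimality of cluster points *)

Unset Implicit Arguments.
Set Strict Implicit.

Theorem theorem4p1 (R : realType) (n : nat) (G : bayesian_game R n)
    (utility_continuous : forall i : 'I_n,
       {within actions G `*` types G,
          continuous (fun x : 'rV[R]_n * 'rV[R]_n => utility G i x.1 x.2)})
    (fd : nat -> @profile R n)
    (fd_argmax : forall d : nat, (1 <= d)%N ->
       argmax (poly_profile G d) (total_payoff G (fd d)) (fd d))
    (f : @profile R n)
    (f_cluster : cluster_point G fd f) :
  argmax (cont_profile G) (total_payoff G f) f.
Proof.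
have [fG f_cl] := f_cluster; split=> // g gG.
apply/lee_addgt0Pr => e e0; have e20 : 0 < e / 2 by rewrite divr_gt0.
have [r [r0 rP]] := filter_ex (filterI (nbhs_right_gt (0 : R))
  (total_payoff_near utility_continuous e20)).
have [D DP] := poly_profile_dense gG r0.
have [d Dd /infnorm_dist_lt fdf] := f_cl r r0 (maxn D 1).
have [gd gdP gdg] := DP d (leq_trans (leq_maxl _ _) Dd).
have [fdP fd_max] := fd_argmax d (leq_trans (leq_maxr _ _) Dd).
have fdG := poly_profile_cont fdP; have gdG := poly_profile_cont gdP.
apply: (@le_trans _ _ (total_payoff G (fd d) gd + (e / 2)%:E)%E).
  by apply: rP => //; exact: dist_ltC.
rewrite [e in leRHS]splitr EFinD addeA leeD2r//.
by apply: le_trans (fd_max _ gdP) _; exact: rP.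
Qed.
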